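(* Let $(X,f)$ be a dynamical system having a subsystem $(Y,f)$ which is a topological extension of the full shift $(\Sigma_p,\sigma)$ for some $p\ge2$. Then there is $\varepsilon_0>0$ such that the following is true: for every $\alpha\in\Sigma_p$ there is $x_\alpha\in Y$ such that $x_\alpha\ne x_\beta$ whenever $\alpha\ne\beta$, and $$C^f_m(x_\alpha,n,\varepsilon)\le C^\sigma_m\left(\alpha,n,\tfrac12\right)\qquad\text{for every }\varepsilon\in(0,\varepsilon_0]\text{ and }m,n\in\mathbb{N}.$$ Consequently, $$\overline{h}_{\mathrm{cor}}(f,x_\alpha)\ge\overline{h}_{\mathrm{cor}}(\sigma,\alpha)\qquad\text{and}\qquad\underline{h}_{\mathrm{cor}}(f,x_\alpha)\ge\underline{h}_{\mathrm{cor}}(\sigma,\alpha)$$ for every $\alpha\in\Sigma_p$.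
   Context: A dynamical system is a pair $(X,f)$ where $X=(X,\varrho)$ is a compact metric space and $f:X\to X$ is continuous. A subsystem $(Y,f)$ is the restriction of $f$ to a nonempty closed set $Y\subseteq X$ with $f(Y)\subseteq Y$. It is a topological extension of $(\Sigma_p,\sigma)$ if there is a continuous surjection $h:Y\to\Sigma_p$ with $h\circ f=\sigma\circ h$ on $Y$. Here $\Sigma_p=\{0,\dots,p-1\}^{\mathbb{N}_0}$ ($\mathbb{N}_0=\{0,1,2,\dots\}$) has the metric equal to $2^{-k}$, $k=\min\{i\ge0:x_i\neq y_i\}$, for $x\ne y$ (and $0$ for $x=y$), and $\sigma((x_i)_i)=(x_{i+1})_i$. $\mathbb{N}=\{1,2,\dots\}$. For any system $(X,f)$ with metric $\varrho$ and $m\in\mathbb{N}$ let $\varrho^f_m(y,z)=\max_{0\le i<m}\varrho(f^i(y),f^i(z))$. For $x\in X$, $m,n\in\mathbb{N}$, $\varepsilon>0$, $$C^f_m(x,n,\varepsilon)=\frac1{n^2}\,\mathrm{card}\{(i,j):0\le i,j<n,\ \varrho^f_m(f^i(x),f^j(x))\le\varepsilon\},$$ $\overline{c}^f_m(x,\varepsilon)=\limsup_{n\to\infty}C^f_m(x,n,\varepsilon)$, $\underline{c}^f_m(x,\varepsilon)=\liminf_{n\to\infty}C^f_m(x,n,\varepsilon)$. The upper and lower local correlation entropies of $f$ at $x$ are $$\overline{h}_{\mathrm{cor}}(f,x)=\lim_{\varepsilon\to0}\limsup_{m\to\infty}\left(-\frac1m\right)\log\underline{c}^f_m(x,\varepsilon),\qquad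 \underline{h}_{\mathrm{cor}}(f,x)=\lim_{\varepsilon\to0}\liminf_{m\to\infty}\left(-\frac1m\right)\log\overline{c}^f_m(x,\varepsilon).$$ *)

(* Defs.v *)
From HB Require Import structures.
From mathcomp Require Import all_boot all_order all_algebra.
From mathcomp Require Import all_classical all_reals all_analysis.

Set Implicit Arguments.
Unset Strict Implicit.
Unset Printing Implicit Defensive.

Import Order.TTheory GRing.Theory Num.Theory.
Import numFieldNormedType.Exports.

Local Open Scope classical_set_scope.
Local Open Scope ring_scope.

(** The parameter [R] of [symb_seq] is where the distance takes its values;
    it only serves to make the metric structure inferable from the type. *)
Definition symb_seq (R : realType) (p : nat) : Type := nat -> 'I_p.

HB.instance Definition _ (R : realType) (p : nat) :=
  Choice.copy (symb_seq R p) (nat -> 'I_p).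

Definition shift_map (R : realType) (p : nat) (x : symb_seq R p) :
  symb_seq R p := fun i => x i.+1.

Definition shift_dist (R : realType) (p : nat) (x y : symb_seq R p) : R :=
  if pselect (exists i, x i != y i) is left neq_xy
  then 2 ^- ex_minn neq_xy else 0.

Section shift_metric.
Context {R : realType} {p : nat}.
Implicit Types x y z : symb_seq R p.

Lemma shift_distxx x : shift_dist x x = 0.
Proof.
by rewrite /shift_dist; case: pselect => // e; exfalso; case: e => i /eqP.
Qed.

Lemma shift_dist_le x y n : (forall i, (i < n)%N -> x i = y i) ->
  shift_dist x y <= 2 ^- n.
Proof.
move=> xy; rewrite /shift_dist; case: pselect => [e|_]; last first.
  by rewrite invr_ge0 exprn_ge0.
case: ex_minnP => k xk _; rewrite lef_pV2 ?posrE ?exprn_gt0//.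
rewrite ler_eXn2l ?ltr1n// leqNgt; apply/negP => /xy xyk.
by rewrite xyk eqxx in xk.
Qed.

Lemma shift_dist_ge x y i : x i != y i -> 2 ^- i <= shift_dist x y.
Proof.
move=> xy; rewrite /shift_dist; case: pselect => [e|[]]; last by exists i.
case: ex_minnP => k _ /(_ _ xy) ki.
by rewrite lef_pV2 ?posrE ?exprn_gt0// ler_eXn2l ?ltr1n.
Qed.

Lemma shift_dist_positivity x y : shift_dist x y = 0 -> x = y.
Proof.
move=> d0; apply/funext => i; apply/eqP; apply: contraT => /shift_dist_ge.
by rewrite d0 leNgt invr_gt0 exprn_gt0.
Qed.

Lemma shift_dist_sym x y : shift_dist x y = shift_dist y x.
Proof.
rewrite /shift_dist; case: pselect => [e|ne]; case: pselect => [e'|ne'] //.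
- by congr (2 ^- _); apply: eq_ex_minn => i; rewrite eq_sym.
- by exfalso; apply: ne'; case: e => i xyi; exists i; rewrite eq_sym.
- by exfalso; apply: ne; case: e' => i xyi; exists i; rewrite eq_sym.
Qed.

Lemma shift_dist_ge0 x y : 0 <= shift_dist x y.
Proof. by rewrite /shift_dist; case: pselect => // e; rewrite invr_ge0 exprn_ge0. Qed.

Lemma shift_dist_triangle y x z :
  shift_dist x z <= shift_dist x y + shift_dist y z.
Proof.
have [e|ne] := pselect (exists i, x i != z i); last first.
  rewrite {1}/shift_dist; case: pselect => // _.
  by rewrite addr_ge0 ?shift_dist_ge0.
case: (ex_minnP e) => k xzk mink.
have xz : shift_dist x z <= 2 ^- k.
  apply: shift_dist_le => i ik; apply/eqP; apply: contraLR ik => /mink.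
  by rewrite -leqNgt.
have [xyk|xyk] := eqVneq (x k) (y k).
  rewrite xyk in xzk.
  by rewrite (le_trans xz)// (le_trans (shift_dist_ge xzk))// lerDr shift_dist_ge0.
by rewrite (le_trans xz)// (le_trans (shift_dist_ge xyk))// lerDl shift_dist_ge0.
Qed.

HB.instance Definition _ := @isMetric.Build R (symb_seq R p)
  (@shift_dist R p) shift_distxx shift_dist_positivity shift_dist_sym
  shift_dist_triangle.

End shift_metric.

Definition subsystem (X : topologicalType) (f : X -> X) (Y : set X) : Prop :=
  [/\ Y !=set0, closed Y & f @` Y `<=` Y].

(** The factor map is a function on [X] of which only the restriction to [Y]
    matters. *)
Definition topological_extension (X Z : topologicalType) (f : X -> X)
    (Y : set X) (g : Z -> Z) : Prop :=
  exists h : X -> Z, [/\ {within Y, continuous h}, h @` Y = [set: Z] &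
    forall y, Y y -> h (f y) = g (h y)].

Section correlation.
Context {R : realType} {X : metricType R} (f : X -> X).

(** The default value [0] of the maximum only matters when [m = 0]. *)
Definition bowen_dist (m : nat) (y z : X) : R :=
  \big[Num.max/0]_(i < m) mdist (iter i f y) (iter i f z).

Definition corr_sum (m : nat) (x : X) (n : nat) (eps : R) : R :=
  #|[pred ij : 'I_n * 'I_n |
      bowen_dist m (iter ij.1 f x) (iter ij.2 f x) <= eps]|%:R / n%:R ^+ 2.

Definition upper_corr (m : nat) (x : X) (eps : R) : \bar R :=
  limn_esup (fun n => (corr_sum m x n eps)%:E).

Definition lower_corr (m : nat) (x : X) (eps : R) : \bar R :=
  limn_einf (fun n => (corr_sum m x n eps)%:E).

(** The quantities under [lim] are nonincreasing in [eps], so both limits exist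
    in [\bar R]; [lne] is the logarithm with [lne 0 = -oo]. *)
Definition upper_corr_entropy (x : X) : \bar R :=
  lim (limn_esup (fun m => (- m%:R^-1)%:E * lne (lower_corr m x eps))%E
    @[eps --> (0 : R)^'+]).

Definition lower_corr_entropy (x : X) : \bar R :=
  lim (limn_einf (fun m => (- m%:R^-1)%:E * lne (upper_corr m x eps))%E
    @[eps --> (0 : R)^'+]).

End correlation.

(* Main.v *)
Require Import Defs.
From mathcomp Require Import all_boot all_order all_algebra.
From mathcomp Require Import all_classical all_reals all_analysis.

Import Order.TTheory GRing.Theory Num.Theory.
Import numFieldNormedType.Exports.

Local Open Scope classical_set_scope.
Local Open Scope ring_scope.

(** Choose [x alpha] in the fibre of the factor map [h] over [alpha]. Since [h]
    is uniformly continuous on the compact set [Y], for every [d > 0] there is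
    [e > 0] such that two points of [Y] at distance at most [e] have images at
    distance at most [d]. As [h] intertwines the two dynamics, the same holds
    for the Bowen distances, with the same [e] for all [m], so that every pair
    counted in the correlation sum of [x alpha] at scale [e] is counted in that
    of [alpha] at scale [d]. The choice [d = 1/2] gives [eps0]; arbitrary [d]
    gives the inequalities between the entropies, these being suprema over the
    scale. *)

(** Compactness enters in its near-covering form: it suffices that each [x] in [Y] has a
    neighbourhood over which all small [e] work at once. *)
Lemma within_compact_unif_continuous {R : realType} {X Z : metricType R}
    {Y : set X} {h : X -> Z} : compact Y -> {within Y, continuous h} ->
  forall d : R, 0 < d -> exists2 e : R, 0 < e &
    forall y z, Y y -> Y z -> mdist y z <= e -> mdist (h y) (h z) <= d.
Proof.
move=> cY ch d d0.
(* The premise [Y y] is part of [P] because the covering neighbourhoods are open in [X] and may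
   leave [Y], where [h] is not controlled. *)
pose P (e : R) (y : X) :=
  Y y -> forall z, Y z -> mdist y z <= e -> mdist (h y) (h z) <= d.
have near_uniform : \forall e \near (0 : R)^'+, Y `<=` P e.
  apply: (compact_near_coveringP Y).1 => // x Yx.
  have d20 : 0 < d / 2 by rewrite divr_gt0.
  have /metricType_numDomainType.cvgr_dist_lt/(_ _ d20)/metricType_numDomainType.nbhs_mdistP[r /= r0 Hr] :
    h @ within Y (nbhs x) --> h x by rewrite (nbhs_subspace_in Yx); exact: ch.
  (* With [y] within [r / 2] of [x] and [z] within [e < r / 2] of [y], both lie within [r] of [x],
     so their images are within [d / 2] of [h x]. *)
  have r20 : 0 < r / 2 by rewrite divr_gt0.
  exists (ball x (r / 2), [set e | e < r / 2]) => [|[y e] /= [xy er] Yy z Yz yz].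
    by split; [exact: nbhsx_ballx|exact: nbhs_right_lt].
  rewrite ballEmdist/= in xy.
  have hxy : mdist (h x) (h y) < d / 2.
    by apply: Hr => //=; apply: lt_trans xy _; rewrite ltr_pdivrMr// ltr_pMr// ltr1n.
  have hxz : mdist (h x) (h z) < d / 2.
    apply: Hr => //=; apply: le_lt_trans (metric_triangle x y z) _.
    by rewrite [r]splitr ltrD// (le_lt_trans yz).
  rewrite (le_trans (metric_triangle _ (h x) _))// [leRHS]splitr metric_sym.
  by rewrite lerD// ltW.
have [e e0 He] : exists2 e, 0 < e & Y `<=` P e.
  near (0 : R)^'+ => e; exists e => //.
  by near: e.
by exists e => // y z Yy Yz; exact: He.
Unshelve. all: by end_near. Qed.

Lemma le_limn_esup {R : realType} (u v : (\bar R)^nat) :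
  (forall n, u n <= v n)%E -> (limn_esup u <= limn_esup v)%E.
Proof.
move=> uv; rewrite !limn_esup_lim; apply: lee_lim; try exact: is_cvg_esups.
apply: nearW => n; apply: ge_ereal_sup => _ [k /= nk <-].
by apply: le_trans (uv k) _; apply: ereal_sup_ubound; exists k.
Qed.

Lemma le_limn_einf {R : realType} (u v : (\bar R)^nat) :
  (forall n, u n <= v n)%E -> (limn_einf u <= limn_einf v)%E.
Proof. by move=> uv; rewrite leeN2; apply: le_limn_esup => n; rewrite leeN2. Qed.

Lemma limn_einf_ge0 {R : realType} (u : (\bar R)^nat) :
  (forall n, 0 <= u n)%E -> (0 <= limn_einf u)%E.
Proof.
(* The bound [0] is rewritten as the lower limit of a constant sequence, so that monotonicity
   applies. *)
move=> u0; have [<- _] := cvg_limn_einf_sup (cvg_cst (0 : \bar R)%E).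
exact: le_limn_einf.
Qed.

Lemma limn_esup_ge0 {R : realType} (u : (\bar R)^nat) :
  (forall n, 0 <= u n)%E -> (0 <= limn_esup u)%E.
Proof. by move=> /limn_einf_ge0/le_trans; apply; exact: limn_einf_sup. Qed.

(** The right limit at [a] of a nonincreasing function is its supremum over []a, +oo[], so [e] may
    depend on [d] in any way. *)
Lemma nonincreasing_le_lim_at_right {R : realType} (F G : R -> \bar R) (a : R) :
  {in `]a, +oo[ &, nonincreasing_fun F} ->
  {in `]a, +oo[ &, nonincreasing_fun G} ->
  (forall d, a < d -> exists2 e, a < e & (F d <= G e)%E) ->
  (lim (F x @[x --> a^'+]) <= lim (G x @[x --> a^'+]))%E.
Proof.
move=> niF niG FG.
rewrite (cvg_lim _ (nonincreasing_at_right_cvge +oo%O _ niF))//.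
rewrite (cvg_lim _ (nonincreasing_at_right_cvge +oo%O _ niG))//.
apply: ge_ereal_sup => _ [d /= + <-]; rewrite in_itv/= andbT => /FG[e ae FGe].
apply: le_trans FGe _; apply: ereal_sup_ubound.
by exists e => //=; rewrite in_itv/= andbT.
Qed.

Section correlation_comparison.
Context {R : realType}.

Lemma corr_sum_ge0 {X : metricType R} (f : X -> X) m x n eps :
  0 <= corr_sum f m x n eps.
Proof. by rewrite divr_ge0// exprn_ge0. Qed.

Lemma le_corr_sum {X Z : metricType R} (f : X -> X) (g : Z -> Z) m x z n d e :
  (forall i j, bowen_dist f m (iter i f x) (iter j f x) <= e ->
               bowen_dist g m (iter i g z) (iter j g z) <= d) ->
  corr_sum f m x n e <= corr_sum g m z n d.
Proof.
move=> fg; rewrite ler_wpM2r ?invr_ge0 ?exprn_ge0// ler_nat.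
by apply: subset_leq_card; apply/fintype.subsetP => ij; rewrite !inE; apply: fg.
Qed.

Lemma corr_sum_homo {X : metricType R} (f : X -> X) m x n :
  {homo corr_sum f m x n : d e / d <= e}.
Proof. by move=> d e de; apply: le_corr_sum => i j /le_trans; apply. Qed.

Context {X Z : metricType R} (f : X -> X) (g : Z -> Z).

(** The factor [- m%:R^-1] reverses the order: fewer close pairs mean a larger rate. Taking [g = f]
    and [z = x] also yields monotonicity of the rate in the scale. *)
Lemma le_upper_corr_rate x z d e :
  (forall m n, corr_sum f m x n e <= corr_sum g m z n d) ->
  (limn_esup (fun m => (- m%:R^-1)%:E * lne (lower_corr g m z d)) <=
   limn_esup (fun m => (- m%:R^-1)%:E * lne (lower_corr f m x e)))%E.
Proof.
move=> fg; apply: le_limn_esup => m.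
rewrite EFinN !mulNe leeN2 lee_wpmul2l ?lee_fin ?invr_ge0//.
rewrite lee_lne ?in_itv/= ?leey ?andbT.
(* Monotonicity of [lne] is applied to nonnegative arguments, whence the last two goals. *)
- by apply: le_limn_einf => n; rewrite lee_fin.
- by apply: limn_einf_ge0 => n; rewrite lee_fin corr_sum_ge0.
- by apply: limn_einf_ge0 => n; rewrite lee_fin corr_sum_ge0.
Qed.

Lemma le_lower_corr_rate x z d e :
  (forall m n, corr_sum f m x n e <= corr_sum g m z n d) ->
  (limn_einf (fun m => (- m%:R^-1)%:E * lne (upper_corr g m z d)) <=
   limn_einf (fun m => (- m%:R^-1)%:E * lne (upper_corr f m x e)))%E.
Proof.
move=> fg; apply: le_limn_einf => m.
rewrite EFinN !mulNe leeN2 lee_wpmul2l ?lee_fin ?invr_ge0//.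
rewrite lee_lne ?in_itv/= ?leey ?andbT.
- by apply: le_limn_esup => n; rewrite lee_fin.
- by apply: limn_esup_ge0 => n; rewrite lee_fin corr_sum_ge0.
- by apply: limn_esup_ge0 => n; rewrite lee_fin corr_sum_ge0.
Qed.

End correlation_comparison.

Section entropy_comparison.
Context {R : realType} {X Z : metricType R} (f : X -> X) (g : Z -> Z) (x : X)
  (z : Z).
Hypothesis fg : forall d, 0 < d -> exists2 e, 0 < e &
  forall m n, corr_sum f m x n e <= corr_sum g m z n d.

Lemma le_upper_corr_entropy :
  (upper_corr_entropy g z <= upper_corr_entropy f x)%E.
Proof.
apply: nonincreasing_le_lim_at_right => [? ? _ _ ?|? ? _ _ ?|d /fg[e e0 ?]].
(* Both rates are nonincreasing in the scale: each system is compared with itself. *)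
- by apply: le_upper_corr_rate => m n; apply: corr_sum_homo.
- by apply: le_upper_corr_rate => m n; apply: corr_sum_homo.
- by exists e => //; apply: le_upper_corr_rate.
Qed.

Lemma le_lower_corr_entropy :
  (lower_corr_entropy g z <= lower_corr_entropy f x)%E.
Proof.
apply: nonincreasing_le_lim_at_right => [? ? _ _ ?|? ? _ _ ?|d /fg[e e0 ?]].
- by apply: le_lower_corr_rate => m n; apply: corr_sum_homo.
- by apply: le_lower_corr_rate => m n; apply: corr_sum_homo.
- by exists e => //; apply: le_lower_corr_rate.
Qed.

End entropy_comparison.

Lemma subsystem_iter {X : topologicalType} {f : X -> X} {Y : set X} {y} i :
  subsystem f Y -> Y y -> Y (iter i f y).
Proof. by case=> _ _ fY Yy; elim: i => //= i IH; apply: fY; exists (iter i f y). Qed.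

Lemma corr_sum_factor {R : realType} {X Z : metricType R} {f : X -> X}
    {g : Z -> Z} {Y : set X} {h : X -> Z} {y : X} {d e : R} m n :
  subsystem f Y -> (forall u, Y u -> h (f u) = g (h u)) -> Y y -> 0 <= d ->
  (forall u v, Y u -> Y v -> mdist u v <= e -> mdist (h u) (h v) <= d) ->
  corr_sum f m y n e <= corr_sum g m (h y) n d.
Proof.
move=> fY hfg Yy d0 hde.
have hiter i u : Y u -> h (iter i f u) = iter i g (h u).
  by move=> Yu; elim: i => //= i <-; apply: hfg; apply: (subsystem_iter _ fY).
(* The maximum starts from [0], so bounding it by [d] requires [0 <= d] besides the bound on each
   term. *)
apply: le_corr_sum => i j /bigmax_leP[_ fe].
apply/bigmax_leP; split => // k _; rewrite -!hiter//; do ?exact: (subsystem_iter _ fY).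
by apply: hde (fe k isT); do 2!apply: (subsystem_iter _ fY).
Qed.

Theorem proposition23 (R : realType) (X : metricType R) (f : X -> X)
    (Y : set X) (p : nat) :
  compact [set: X] -> continuous f -> subsystem f Y ->
  (2 <= p)%N -> topological_extension f Y (@shift_map R p) ->
  exists2 eps0 : R, 0 < eps0 &
  exists x : symb_seq R p -> X,
    [/\ forall alpha, Y (x alpha),
        forall alpha beta, alpha <> beta -> x alpha <> x beta,
        forall alpha (eps : R) (m n : nat),
          0 < eps <= eps0 -> (0 < m)%N -> (0 < n)%N ->
          corr_sum f m (x alpha) n eps <= corr_sum (@shift_map R p) m alpha n (1 / 2),
        forall alpha, (upper_corr_entropy (@shift_map R p) alpha <=
                       upper_corr_entropy f (x alpha))%E &
        forall alpha, (lower_corr_entropy (@shift_map R p) alpha <=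
                       lower_corr_entropy f (x alpha))%E].
Proof.
move=> cX _ fY _ [h [ch hY hf]].
have cY : compact Y by case: fY => _ clY _; apply: subclosed_compact cX _.
have hunif := within_compact_unif_continuous cY ch.
(* A section of [h] with values in [Y]; having [h] as left inverse, it is injective. *)
have [x xY hx] : exists2 x : symb_seq R p -> X,
    forall alpha, Y (x alpha) & forall alpha, h (x alpha) = alpha.
  have /choice[x Hx] alpha : exists y, Y y /\ h y = alpha.
    by have : [set: symb_seq R p] alpha by []; rewrite -hY => -[y ? ?]; exists y.
  by exists x => alpha; have [] := Hx alpha.
have sum_le alpha d e m n : 0 <= d ->
    (forall u v, Y u -> Y v -> mdist u v <= e -> mdist (h u) (h v) <= d) ->
    corr_sum f m (x alpha) n e <= corr_sum (@shift_map R p) m alpha n d.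
  by move=> d0 hde; rewrite -{2}(hx alpha); apply: (corr_sum_factor m n fY hf).
have scales alpha d : 0 < d -> exists2 e, 0 < e & forall m n,
    corr_sum f m (x alpha) n e <= corr_sum (@shift_map R p) m alpha n d.
  by move=> d0; have [e e0 hde] := hunif d d0; exists e => // m n;
    apply: sum_le => //; exact: ltW.
(* Uniform continuity gives [eps0] before any [alpha] is fixed; a smaller [eps] is handled by
   monotonicity of [corr_sum] in the scale. *)
have [eps0 eps00 heps0] := hunif (1 / 2) ltac:(by rewrite divr_gt0).
exists eps0; first exact: eps00.
exists x; split; first exact: xY.
- by move=> alpha beta ab xab; apply: ab; rewrite -(hx alpha) xab hx.
- move=> alpha eps m n /andP[_ epsle] _ _.
  by apply: le_trans (corr_sum_homo _ _ _ _ _ _ epsle) _; apply: sum_le => //;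
    rewrite divr_ge0.
- by move=> alpha; apply: le_upper_corr_entropy; exact: scales.
- by move=> alpha; apply: le_lower_corr_entropy; exact: scales.
Qed.
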